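(* Let $(X,\{R_i\}_{i=0}^5)$ be a skew-symmetric association scheme on triples, where $R_0,\dots,R_3$ are the trivial relations, with intersection numbers satisfying $p_{444}^4=p_{445}^5=p_{455}^4=p_{555}^5=0$. Then $(X,\nabla)$ is a regular skew two-graph, where $\nabla=\{(xyz)\in\mathcal C_3:(x,y,z)\in R_4\}$.
   Context: $X$ is a finite set, $\mathcal C_3$ is the set of $3$-cycles in the symmetric group on $X$; $(xyz)$ denotes the $3$-cycle $x\mapsto y\mapsto z\mapsto x$. A skew two-graph is a pair $(X,\nabla)$ with $\nabla\subseteq\mathcal C_3$ such that (S1) for every $\tau\in\mathcal C_3$ exactly one of $\tau,\tau^{-1}$ is in $\nabla$ and (S2) for every $4$-subset $\{x,y,z,w\}\subseteq X$, $\nabla$ contains an even number of $(xyz),(xwy),(xzw),(ywz)$; it is regular if the number of $z$ with $(xyz)\in\nabla$ is the same for all ordered pairs of distinct $x,y$. The trivial relations are $R_0=\{(x,x,x)\}$, $R_1=\{(x,y,y):x\ne y\}$, $R_2=\{(x,y,x):x\neq y\}$, $R_3=\{(x,x,y):x\neq y\}$. For $\sigma\in S_3$ and $R\subseteq X^3$, $\sigma(R)=\{(y_{\sigma(1)},y_{\sigma(2)},y_{\sigma(3)}):(y_1,y_2,y_3)\in R\}$. A partition $\{R_0,\dots,R_m\}$ of $X^3$ is an association scheme on triples if: (I) $R_0,\dots,R_3$ are the trivial relations; (II) for each $i$ and $\sigma\in S_3$, $\sigma(R_i)=R_j$ for some $j$; (III) for distinct $y,z$ and each $i$, $|\{x:(x,y,z)\in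 R_i\}|$ depends only on $i$; (IV) for all $i,j,k,\ell$ and $(x,y,z)\in R_\ell$, the number $p_{ijk}^\ell=|\{w\in X:(w,y,z)\in R_i,(x,w,z)\in R_j,(x,y,w)\in R_k\}|$ depends only on $i,j,k,\ell$. Such a scheme with $m=5$ is skew-symmetric if (SS1) $R_4,R_5$ are invariant under $(123)\in S_3$ and (SS2) $\sigma(R_4)\cap R_4=\sigma(R_5)\cap R_5=\emptyset$ for $\sigma=(12)$. *)

(* Defs.v *)
From mathcomp Require Import all_boot all_fingroup.

Set Implicit Arguments.
Unset Strict Implicit.
Unset Printing Implicit Defensive.

(* The 3-cycle x |-> y |-> z |-> x, for distinct x, y, z: the product s * t
   of permutations applies s first. *)
Definition cycle3 (X : finType) (x y z : X) : {perm X} :=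
  (tperm x y * tperm x z)%g.

Definition three_cycles (X : finType) : {set {perm X}} :=
  [set s | [exists x, exists y, exists z,
              uniq [:: x; y; z] && (s == cycle3 x y z)]].

Record skew_two_graph (X : finType) (nabla : {set {perm X}}) : Prop := {
  stg_sub : nabla \subset three_cycles X;
  stg_S1 : forall tau : {perm X}, tau \in three_cycles X ->
    (tau \in nabla) (+) ((tau^-1)%g \in nabla);
  stg_S2 : forall x y z w : X, uniq [:: x; y; z; w] ->
    ~~ odd #|nabla :&: [set cycle3 x y z; cycle3 x w y;
                            cycle3 x z w; cycle3 y w z]|
}.

Definition regular_nabla (X : finType) (nabla : {set {perm X}}) : Prop :=
  exists k : nat, forall x y : X, x != y ->
    #|[set z | uniq [:: x; y; z] && (cycle3 x y z \in nabla)]| = k.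

Definition regular_skew_two_graph (X : finType) (nabla : {set {perm X}}) : Prop :=
  skew_two_graph nabla /\ regular_nabla nabla.

(* Coordinates of triples are numbered 0, 1, 2. *)
Definition perm_rel (X : finType) (s : 'S_3) (A : {set 3.-tuple X}) :
    {set 3.-tuple X} :=
  [set [tuple tnth t (s i) | i < 3] | t in A].

Definition intersection_numbers (X : finType) (m : nat)
    (R : 'I_m.+1 -> {set 3.-tuple X})
    (p : 'I_m.+1 -> 'I_m.+1 -> 'I_m.+1 -> 'I_m.+1 -> nat) : Prop :=
  forall (i j k l : 'I_m.+1) (x y z : X), [tuple x; y; z] \in R l ->
    #|[set w | [&& [tuple w; y; z] \in R i, [tuple x; w; z] \in R j
                 & [tuple x; y; w] \in R k]]| = p i j k l.

(* The relations are indexed without repetition, and [partition] requires the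
   blocks to be nonempty; in particular an intersection number p i j k l is
   uniquely determined by R. *)
Record assoc_scheme_on_triples (X : finType) (m : nat)
    (R : 'I_m.+1 -> {set 3.-tuple X}) : Prop := {
  ast_inj : injective R;
  ast_partition : partition [set R i | i : 'I_m.+1] [set: 3.-tuple X];
  ast_ge3 : 3 <= m;
  ast_R0 : R (inord 0) = [set [tuple x; x; x] | x : X];
  ast_R1 : R (inord 1) = [set [tuple x; y; y] | x in X, y in X & x != y];
  ast_R2 : R (inord 2) = [set [tuple x; y; x] | x in X, y in X & x != y];
  ast_R3 : R (inord 3) = [set [tuple x; x; y] | x in X, y in X & x != y];
  ast_sym : forall (i : 'I_m.+1) (s : 'S_3),
    exists j : 'I_m.+1, perm_rel s (R i) = R j;
  ast_valency : forall i : 'I_m.+1, exists n : nat,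
    forall y z : X, y != z -> #|[set x | [tuple x; y; z] \in R i]| = n;
  ast_intersection : exists p, intersection_numbers R p
}.

Definition perm123 : 'S_3 := cycle3 (inord 0) (inord 1) (inord 2).
Definition perm12 : 'S_3 := tperm (inord 0) (inord 1).

Record skew_symmetric_scheme (X : finType) (R : 'I_6 -> {set 3.-tuple X}) :
    Prop := {
  sss_scheme : assoc_scheme_on_triples R;
  sss_SS1_4 : perm_rel perm123 (R (inord 4)) = R (inord 4);
  sss_SS1_5 : perm_rel perm123 (R (inord 5)) = R (inord 5);
  sss_SS2_4 : perm_rel perm12 (R (inord 4)) :&: R (inord 4) = set0;
  sss_SS2_5 : perm_rel perm12 (R (inord 5)) :&: R (inord 5) = set0
}.

Definition nabla_of (X : finType) (A : {set 3.-tuple X}) : {set {perm X}} :=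
  [set s | [exists x, exists y, exists z,
     [&& uniq [:: x; y; z], s == cycle3 x y z & [tuple x; y; z] \in A]]].

(* Main.v *)
Require Import Defs.
From mathcomp Require Import all_boot all_fingroup.

Set Implicit Arguments.
Unset Strict Implicit.
Unset Printing Implicit Defensive.

(** Write [T x y z] for [(x, y, z) \in R 4].  On distinct points [R 5] is the
    complement of [R 4], so by (SS1) and (SS2) [T] is invariant under rotation
    and negated by transpositions.  For distinct [x, y, z, w] the parity condition (S2) then
    says that the number of true statements among [T w y z], [T x w z],
    [T x y w] is even if [T x y z] holds and odd otherwise.  The excluded
    counts 3 and 1 (resp. 2 and 0) are those forbidden by the vanishing of
    [p444_4] and [p455_4] (resp. [p445_5] and [p555_5]), up to a rotation of
    [(x, y, z)].  Regularity is axiom (III) for [R 4]. *)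

(** * Three-cycles and the ordered triples that represent them *)

Section ThreeCycles.

Variable X : finType.
Implicit Types (x y z u w : X) (A : {set 3.-tuple X}).

Lemma cycle3E x y z u : uniq [:: x; y; z] ->
  cycle3 x y z u = if u == x then y else if u == y then z
                   else if u == z then x else u.
Proof.
rewrite /= !inE negb_or andbT => /andP[/andP[xy xz] yz].
rewrite permM; have [->|ux] := eqVneq u x.
  by rewrite tpermL tpermD // eq_sym.
have [->|uy] := eqVneq u y; first by rewrite tpermR tpermL.
rewrite (@tpermD _ x y) 1?eq_sym //.
by have [->|uz] := eqVneq u z; rewrite ?tpermR // tpermD // eq_sym.
Qed.

Lemma uniq3_rot x y z : uniq [:: y; z; x] = uniq [:: x; y; z].
Proof. exact: (rot_uniq 1 [:: x; y; z]). Qed.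

Lemma uniq3_swap x y z : uniq [:: y; x; z] = uniq [:: x; y; z].
Proof. by apply: perm_uniq; rewrite (perm_catCA [:: y] [:: x] [:: z]). Qed.

Lemma cycle3V x y z : uniq [:: x; y; z] ->
  ((cycle3 x y z)^-1)%g = cycle3 y x z.
Proof.
move=> U; apply/permP=> u.
suff K : cycle3 x y z (cycle3 y x z u) = u by rewrite -{1}K permK.
rewrite (cycle3E _ U) cycle3E 1?uniq3_swap //.
move: U; rewrite /= !inE negb_or andbT => /andP[/andP[xy xz] yz].
have [->|uy] := eqVneq u y; first by rewrite eqxx.
have [->|ux] := eqVneq u x.
  by rewrite !(eq_sym z) (negbTE xz) (negbTE yz) eqxx.
have [->|uz] := eqVneq u z; first by rewrite eqxx eq_sym (negbTE xy).
by rewrite (negbTE ux) (negbTE uy) (negbTE uz).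
Qed.

(** A three-cycle and one point that it moves determine the triple, since the other two entries are
    the successive images of that point. *)
Lemma cycle3_inj x y z a b c : uniq [:: x; y; z] -> uniq [:: a; b; c] ->
  cycle3 x y z = cycle3 a b c ->
  [\/ [:: x; y; z] = [:: a; b; c], [:: x; y; z] = [:: b; c; a]
    | [:: x; y; z] = [:: c; a; b]].
Proof.
move=> U V E.
have Ey : cycle3 a b c x = y by rewrite -E cycle3E // eqxx.
have Ez : cycle3 a b c y = z.
  rewrite -E cycle3E //; move: U; rewrite /= !inE negb_or eqxx.
  by case/andP=> /andP[/negbTE xy _] _; rewrite eq_sym xy.
have Exy : x != y by move: U; rewrite /= !inE negb_or -andbA => /and3P[].
(* Everything is now expressed through [x], and [x != y] says that the cycle on [a], [b], [c] moves
   [x]. Hence [x] is one of these three points, one for each rotation. *)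
rewrite -Ez -Ey; move: Exy; rewrite -Ey !(cycle3E _ V).
move: V; rewrite /= !inE negb_or andbT => /andP[/andP[ab ac] bc].
have [->|xa] := eqVneq x a.
  by rewrite (eq_sym b) (negbTE ab) eqxx; constructor 1.
have [->|xb] := eqVneq x b.
  by rewrite !(eq_sym c) (negbTE ac) (negbTE bc) eqxx; constructor 2.
by have [->|xc] := eqVneq x c; rewrite eqxx //; constructor 3.
Qed.

(** [nabla_of] asks only for some representing triple. Representatives differ by a rotation, so for
    rotation-invariant [A] any of them decides membership. *)
Lemma mem_nabla_of A x y z :
  (forall a b c, [tuple a; b; c] \in A -> [tuple b; c; a] \in A) ->
  uniq [:: x; y; z] ->
  (cycle3 x y z \in nabla_of A) = ([tuple x; y; z] \in A).
Proof.
move=> rotA U; rewrite inE; apply/idP/idP; last first.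
  by move=> Axyz; apply/existsP; exists x; apply/existsP; exists y;
     apply/existsP; exists z; rewrite U eqxx.
case/existsP=> a /existsP[b /existsP[c /and3P[V /eqP E Aabc]]].
by case: (cycle3_inj U V E) => -[-> -> ->] //;
   [exact: rotA | exact/rotA/rotA].
Qed.

End ThreeCycles.

(** * Coordinate permutations of relations *)

Lemma perm_rel123 (X : finType) (A : {set 3.-tuple X}) (x y z : X) :
  [tuple x; y; z] \in A -> [tuple y; z; x] \in perm_rel perm123 A.
Proof.
move=> Axyz; apply/imsetP; exists [tuple x; y; z] => //.
have U : uniq [:: inord 0 : 'I_3; inord 1; inord 2].
  by rewrite /= !inE -!val_eqE /= !inordK.
apply: eq_from_tnth => i; have E : perm123 i = _ := cycle3E i U.
rewrite tnth_mktuple {}E.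
by case: i => [[|[|[|i]]] Hi] //; rewrite -!val_eqE /= !inordK //=
  !(tnth_nth x) /= !inordK.
Qed.

Lemma perm_rel123_id (X : finType) (A : {set 3.-tuple X}) (x y z : X) :
  perm_rel perm123 A = A ->
  ([tuple y; z; x] \in A) = ([tuple x; y; z] \in A).
Proof.
move=> rotA; have rot a b c : [tuple a; b; c] \in A -> [tuple b; c; a] \in A.
  by move/perm_rel123; rewrite rotA.
(* The rotation has order three, so its inverse is the rotation applied twice. *)
by apply/idP/idP=> [/rot/rot|/rot].
Qed.

Lemma perm_rel12 (X : finType) (A : {set 3.-tuple X}) (x y z : X) :
  [tuple x; y; z] \in A -> [tuple y; x; z] \in perm_rel perm12 A.
Proof.
move=> Axyz; apply/imsetP; exists [tuple x; y; z] => //.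
apply: eq_from_tnth => i.
have E : perm12 i = _ := permE _ i.
rewrite tnth_mktuple {}E /=.
by case: i => [[|[|[|i]]] Hi] //; rewrite -!val_eqE /= !inordK //=
  !(tnth_nth x) /= ?inordK.
Qed.

(** Turns the cardinality in (S2) into a sum of four truth values, once the four cycles are known to
    be distinct. *)
Lemma card_setI_seq (T : finType) (A : {set T}) (s : seq T) : uniq s ->
  #|A :&: [set x in s]| = count (mem A) s.
Proof.
move=> Us; rewrite -size_filter -(card_uniqP (filter_uniq (mem A) Us)).
by apply: eq_card => x; rewrite !inE mem_filter.
Qed.

Lemma uniq_cycle3_quad (X : finType) (x y z w : X) : uniq [:: x; y; z; w] ->
  uniq [:: cycle3 x y z; cycle3 x w y; cycle3 x z w; cycle3 y w z].
Proof.
rewrite /= !inE !negb_or !andbT => /and3P[/and3P[xy xz xw] /andP[yz yw] zw].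
have mv (a b c u : X) : uniq [:: a; b; c] -> u \in [:: a; b; c] ->
    cycle3 a b c u != u.
  move=> U; rewrite cycle3E // !inE; move: U; rewrite /= !inE negb_or andbT.
  case/andP=> /andP[ab ac] bc; have [->|_] := eqVneq u a.
    by rewrite (eq_sym b a).
  have [->|_] := eqVneq u b; first by rewrite (eq_sym c b).
  by case: eqVneq => // ->.
have fx (a b c u : X) : uniq [:: a; b; c] -> u \notin [:: a; b; c] ->
    cycle3 a b c u = u.
  move=> U; rewrite cycle3E // !inE !negb_or.
  by case/and3P=> /negbTE-> /negbTE-> /negbTE->.
(* Each of the four cycles is told apart by the only point of the quadruple
   that it fixes. *)
have ne (a b c a' b' c' u : X) : uniq [:: a; b; c] -> uniq [:: a'; b'; c'] ->
    u \notin [:: a; b; c] -> u \in [:: a'; b'; c'] ->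
    cycle3 a b c != cycle3 a' b' c'.
  move=> U U' Hu Hu'; apply/eqP=> E.
  by have := mv _ _ _ _ U' Hu'; rewrite -E fx ?eqxx.
have ops := (xy, xz, xw, yz, yw, zw, eqxx, orbT, eq_sym y x, eq_sym z x,
  eq_sym w x, eq_sym z y, eq_sym w y, eq_sym w z).
rewrite (ne x y z x w y w) ?(ne x y z x z w w) ?(ne x y z y w z w)
  ?(ne x w y x z w z) ?(ne x w y y w z z) ?(ne x z w y w z y) //=;
  by rewrite ?inE ?negb_or !ops.
Qed.

(** * Nontrivial relations of a skew-symmetric scheme *)

Section SkewSymmetricScheme.

Variables (X : finType) (R : 'I_6 -> {set 3.-tuple X}).
Hypothesis HR : skew_symmetric_scheme R.
Implicit Types x y z w : X.

Let HS := sss_scheme HR.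

(** The partition axiom separates distinct blocks; injectivity of [R] carries this over to distinct
    indices. *)
Lemma rel_disjoint t i j : t \in R i -> t \in R j -> i = j.
Proof.
move=> ti tj; apply: (ast_inj HS); apply/eqP; apply: contraT => neq.
case/and3P: (ast_partition HS) => _ /trivIsetP tI _.
have /pred0P/(_ t) := tI _ _ (imset_f R (isT : i \in 'I_6))
  (imset_f R (isT : j \in 'I_6)) neq.
by rewrite /= ti tj.
Qed.

Lemma rel_cover t : exists i, t \in R i.
Proof.
case/and3P: (ast_partition HS) => /eqP cov _ _.
have : t \in [set: 3.-tuple X] by rewrite inE.
by rewrite -cov => /bigcupP[_ /imsetP[i _ ->] ti]; exists i.
Qed.

(** A triple with a repeated entry already lies in one of the four trivial relations, which are
    disjoint from [R 4]. *)
Lemma rel4_uniq x y z : [tuple x; y; z] \in R (inord 4) -> uniq [:: x; y; z].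
Proof.
move=> H4.
have no i : i < 4 -> [tuple x; y; z] \notin R (inord i).
  move=> i4; apply/negP=> /(rel_disjoint H4)/(congr1 val)/eqP.
  by rewrite /= !inordK ?gtn_eqF // (ltn_trans i4).
rewrite /= !inE negb_or andbT; have [xy|xy] /= := eqVneq x y; last first.
  have [xz|xz] /= := eqVneq x z.
    move/negP: (no 2 isT); case; rewrite (ast_R2 HS) -xz.
    by apply/imset2P; exists x y; rewrite ?inE.
  apply/eqP=> yz; move/negP: (no 1 isT); case; rewrite (ast_R1 HS) -yz.
  by apply/imset2P; exists x y; rewrite ?inE.
have [xz|xz] := eqVneq x z.
  by move/negP: (no 0 isT); case; rewrite (ast_R0 HS) -xy -xz; apply: imset_f.
move/negP: (no 3 isT); case; rewrite (ast_R3 HS) -xy.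
by apply/imset2P; exists x z; rewrite ?inE.
Qed.

Lemma rel5_compl x y z : uniq [:: x; y; z] ->
  ([tuple x; y; z] \in R (inord 5)) = ([tuple x; y; z] \notin R (inord 4)).
Proof.
rewrite /= !inE negb_or andbT => /andP[/andP[xy xz] yz].
apply/idP/idP=> [H5|H4].
  apply/negP=> /(rel_disjoint H5)/(congr1 val)/eqP.
  by rewrite /= !inordK.
have [i] := rel_cover [tuple x; y; z].
(* This puts the index in the form used by the axioms for the trivial relations. Distinctness of the
   entries then rules out the indices 0 to 3. *)
have -> : i = inord (val i) by rewrite inord_val.
case: i => [[|[|[|[|[|[|i]]]]]] Hi] //= Hxyz; last 1 first.
- by rewrite Hxyz in H4.
- move: Hxyz; rewrite (ast_R0 HS) => /imsetP[a _ [ax ay _]].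
  by rewrite ax ay eqxx in xy.
- move: Hxyz; rewrite (ast_R1 HS) => /imset2P[a b _ _ [_ yb zb]].
  by rewrite yb zb eqxx in yz.
- move: Hxyz; rewrite (ast_R2 HS) => /imset2P[a b _ _ [xa _ za]].
  by rewrite xa za eqxx in xz.
- move: Hxyz; rewrite (ast_R3 HS) => /imset2P[a b _ _ [xa ya _]].
  by rewrite xa ya eqxx in xy.
Qed.

(** Skewness of [R 4] forbids both orientations from lying in [R 4]. Skewness of its complement
    [R 5] forbids both from lying outside. *)
Lemma rel4_swap x y z : uniq [:: x; y; z] ->
  ([tuple y; x; z] \in R (inord 4)) = ([tuple x; y; z] \notin R (inord 4)).
Proof.
move=> U; apply/idP/idP=> [H|].
  apply/negP=> H'; have := sss_SS2_4 HR.
  by move/setP/(_ [tuple x; y; z]); rewrite !inE H' perm_rel12.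
rewrite -rel5_compl // => H; rewrite -[_ \in _]negbK -rel5_compl 1?uniq3_swap //.
apply/negP=> H'; have := sss_SS2_5 HR.
by move/setP/(_ [tuple x; y; z]); rewrite !inE H perm_rel12.
Qed.

Lemma intersection_eq0 p i j k l x y z w : intersection_numbers R p ->
  p i j k l = 0 -> [tuple x; y; z] \in R l ->
  ~~ [&& [tuple w; y; z] \in R i, [tuple x; w; z] \in R j
       & [tuple x; y; w] \in R k].
Proof.
move=> Hp p0 Hl; move: (Hp i j k l x y z Hl); rewrite p0 => /cards0_eq/setP.
by move/(_ w); rewrite !inE => ->.
Qed.

End SkewSymmetricScheme.

(** * Regularity, (S1) and (S2) for the cycles coming from [R 4] *)

Theorem theorem3p3 (X : finType) (R : 'I_6 -> {set 3.-tuple X})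
    (p : 'I_6 -> 'I_6 -> 'I_6 -> 'I_6 -> nat)
    (HR : skew_symmetric_scheme R)
    (Hp : intersection_numbers R p)
    (p444_4 : p (inord 4) (inord 4) (inord 4) (inord 4) = 0)
    (p445_5 : p (inord 4) (inord 4) (inord 5) (inord 5) = 0)
    (p455_4 : p (inord 4) (inord 5) (inord 5) (inord 4) = 0)
    (p555_5 : p (inord 5) (inord 5) (inord 5) (inord 5) = 0) :
  regular_skew_two_graph (nabla_of (R (inord 4))).
Proof.
have rotE x y z := perm_rel123_id x y z (sss_SS1_4 HR).
have rot5E x y z := perm_rel123_id x y z (sss_SS1_5 HR).
have rot4 x y z : [tuple x; y; z] \in R (inord 4) ->
  [tuple y; z; x] \in R (inord 4) by rewrite (rotE x).
have rot5 x y z : [tuple x; y; z] \in R (inord 5) ->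
  [tuple y; z; x] \in R (inord 5) by rewrite (rot5E x).
have compl := rel5_compl HR; have swap := rel4_swap HR.
split; last first.
  have [n Hn] := ast_valency (sss_scheme HR) (inord 4).
  exists n => x y xy; rewrite -(Hn x y xy); apply: eq_card => z.
  (* Axiom (III) varies the first coordinate and regularity the third; a rotation matches them.
     Axiom (III) does not ask for distinct entries, but [rel4_uniq] supplies them. *)
  rewrite inE [RHS]inE -rotE; apply/andP/idP=> [[U]|H].
    by rewrite mem_nabla_of.
  by have U := rel4_uniq HR H; rewrite mem_nabla_of.
split.
- apply/subsetP=> s; rewrite !inE.
  case/existsP=> x /existsP[y /existsP[z /and3P[U E _]]].
  by apply/existsP; exists x; apply/existsP; exists y;
     apply/existsP; exists z; rewrite U E.
- move=> tau; rewrite inE.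
  case/existsP=> x /existsP[y /existsP[z /andP[U /eqP->]]].
  have U' : uniq [:: y; x; z] by rewrite uniq3_swap.
  rewrite cycle3V // !mem_nabla_of // (swap _ _ _ U).
  by case: (_ \in _).
move=> x y z w U4.
have U3 (s : seq X) : subseq s [:: x; y; z; w] -> uniq s.
  by move/subseq_uniq; apply.
have Uxyz : uniq [:: x; y; z] by apply: U3; rewrite /= !eqxx.
have Uxyw : uniq [:: x; y; w].
  by apply: (U3 _ (mask_subseq [:: true; true; false; true] _)).
have Uxzw : uniq [:: x; z; w].
  by apply: (U3 _ (mask_subseq [:: true; false; true; true] _)).
have Uyzw : uniq [:: y; z; w].
  by apply: (U3 _ (mask_subseq [:: false; true; true; true] _)).
have Uwyz : uniq [:: w; y; z] by rewrite -uniq3_rot.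
have Uxwy : uniq [:: x; w; y] by rewrite uniq3_rot uniq3_swap.
have Uxwz : uniq [:: x; w; z] by rewrite uniq3_rot uniq3_swap.
have Uywz : uniq [:: y; w; z] by rewrite uniq3_swap.
have -> : [set cycle3 x y z; cycle3 x w y; cycle3 x z w; cycle3 y w z] =
    [set s in [:: cycle3 x y z; cycle3 x w y; cycle3 x z w; cycle3 y w z]].
  by apply/setP=> s; rewrite !inE -!orbA.
rewrite card_setI_seq ?uniq_cycle3_quad //= !mem_nabla_of //.
(* The three cycles through [w] become negations of the three statements that occur in the
   intersection numbers, where [w] replaces one entry of [(x, y, z)]. *)
have -> : ([tuple x; w; y] \in R (inord 4)) =
    ([tuple x; y; w] \notin R (inord 4)).
  by rewrite (rotE y x w) (swap x y w Uxyw).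
have -> : ([tuple x; z; w] \in R (inord 4)) =
    ([tuple x; w; z] \notin R (inord 4)).
  by rewrite (rotE w x z) (swap x w z Uxwz).
rewrite (swap w y z Uwyz).
have no i j k l a b c := @intersection_eq0 _ _ p i j k l a b c w Hp.
have [H4|N4] := boolP ([tuple x; y; z] \in R (inord 4)).
  (* [p455_4] excludes that only the first of the three statements holds. Applied to the two
     rotations of [(x, y, z)], it excludes the same for the other two statements. *)
  have := no _ _ _ _ _ _ _ p444_4 H4.
  have := no _ _ _ _ _ _ _ p455_4 H4.
  have := no _ _ _ _ _ _ _ p455_4 (rot4 _ _ _ H4).
  have := no _ _ _ _ _ _ _ p455_4 (rot4 _ _ _ (rot4 _ _ _ H4)).
  (* Rotations bring all constraints back to the same three statements, and [compl] removes [R 5]; a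
     check of eight truth assignments remains. *)
  rewrite (rotE y w x) (rotE x y w) (rot5E y z w) (rot5E w y z)
    (rot5E w z x) (rot5E x w z) (rotE x w z) (rot5E x y w) !compl //.
  by do 3!case: (_ \in _).
have H5 : [tuple x; y; z] \in R (inord 5) by rewrite compl.
(* Dually, [p555_5] excludes that none of the three statements holds, and [p445_5] with the
   rotations excludes each way for exactly two to hold. *)
have := no _ _ _ _ _ _ _ p555_5 H5.
have := no _ _ _ _ _ _ _ p445_5 H5.
have := no _ _ _ _ _ _ _ p445_5 (rot5 _ _ _ H5).
have := no _ _ _ _ _ _ _ p445_5 (rot5 _ _ _ (rot5 _ _ _ H5)).
rewrite (rotE y w x) (rotE x y w) (rotE y z w) (rotE w y z)
  (rot5E w z x) (rot5E x w z) (rotE x w z) (rot5E w y z) !compl //.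
by do 3!case: (_ \in _).
Qed.
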